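(* Let $r\ge 1$ and, for $1\le i\le r$, let $a^i=(a^i_t)_{t\ge 0}$ be the binary output sequence of an LFSR over $GF(2)$ with primitive feedback polynomial of degree $p_i$ and nonzero initial state, so that $a^i$ has period $n_i=2^{p_i}-1$. Assume that $n_1,\dots,n_r$ are pairwise coprime. Let $s_t=a^1_t a^2_t\cdots a^r_t$ (product in $GF(2)$) be the product sequence, with period $n$, where $n\mid 2^m-1$ for a positive integer $m$. Let $\alpha_i\in GF(2^{p_i})$ be a root of the minimal polynomial of $a^i$ for $1\le i\le r$, and let $\gamma\in GF(2^m)$ be a root of the minimal polynomial of $s$. Let $A^i$ be the DFT spectrum of $a^i$ with respect to $\alpha_i$, and let $S$ be the DFT spectrum of $s$ with respect to $\gamma$. Let $0\le k\le n-1$ be such that $A^i_{(k \bmod n_i)}\ne 0$ for all $1\le i\le r$, and write $A^i_{(k \bmod n_i)}=\alpha_i^{d_i}$. Then $S_k=\gamma^d$, where $d$ is the solution, given by the Chinese Remainder Theorem, of $$d\equiv d_1 \pmod{n_1},\quad d\equiv d_2 \pmod{n_2},\quad\dots,\quad d\equiv d_r \pmod{n_r}.$$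
   Context: An LFSR over $GF(2)$ with feedback polynomial $f(x)=x^p+\sum_{j=0}^{p-1}c_jx^j\in GF(2)[x]$ outputs a binary sequence satisfying $a_{t+p}=\sum_{j=0}^{p-1}c_j a_{t+j}$ for all $t\ge 0$, with initial state $(a_0,\dots,a_{p-1})$. The minimal polynomial of a nonzero periodic binary sequence $s$ is the monic polynomial $x^l+\sum_{j=0}^{l-1}c_jx^j\in GF(2)[x]$ of least degree such that $s_{t+l}=\sum_{j=0}^{l-1}c_js_{t+j}$ for all $t\ge 0$. DFT: for a binary sequence $s$ of period $n$ and an element $\gamma$ of multiplicative order $n$ in an extension field of $GF(2)$, the DFT spectrum of $s$ with respect to $\gamma$ is $S=(S_0,\dots,S_{n-1})$ with $S_k=\sum_{t=0}^{n-1}s_t\gamma^{tk}$. The ''degree'' of a nonzero spectral component is the exponent when that component is written as a power of the element with respect to which the DFT is taken ($d_i$ for $A^i$ with respect to $\alpha_i$, and $d$ for $S$ with respect to $\gamma$). *)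

(* Defs.v *)
From HB Require Import structures.
From mathcomp Require Import all_boot all_order all_algebra all_field.

Set Implicit Arguments.
Unset Strict Implicit.
Unset Printing Implicit Defensive.

Import GRing.Theory.
Local Open Scope ring_scope.

Definition binseq := nat -> 'F_2.

(* Intended for monic f.  Writing f = x^l + \sum_(j < l) c_j x^j, so that
   l = (size f).-1 and c_j = f`_j, this is
   s_(t+l) = \sum_(j < l) c_j s_(t+j) for all t; signs are irrelevant in
   characteristic 2.  For f = 1 (l = 0) it says that s = 0. *)
Definition satisfies_recurrence (f : {poly 'F_2}) (s : binseq) : Prop :=
  forall t : nat,
    s (t + (size f).-1)%N = \sum_(j < (size f).-1) f`_j * s (t + j)%N.

Definition lfsr_output (f : {poly 'F_2}) (a : binseq) : Prop :=
  f \is monic /\ satisfies_recurrence f a.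

Definition nonzero_initial_state (f : {poly 'F_2}) (a : binseq) : Prop :=
  exists2 j : nat, (j < (size f).-1)%N & a j != 0.

Definition is_minimal_poly (s : binseq) (f : {poly 'F_2}) : Prop :=
  [/\ f \is monic, satisfies_recurrence f s
    & forall g : {poly 'F_2},
        g \is monic -> satisfies_recurrence g s -> (size f <= size g)%N].

(* "Period" means least positive period: the DFT below is taken with respect
   to an element of multiplicative order exactly n. *)
Definition has_period (s : binseq) (n : nat) : Prop :=
  [/\ (0 < n)%N, forall t : nat, s (t + n)%N = s t
    & forall n' : nat, (0 < n')%N -> (forall t : nat, s (t + n')%N = s t) ->
        (n <= n')%N].

(* S_k = \sum_(t < n) s_t g^(t k), the bits s_t acting as scalars of the
   GF(2)-algebra L; the spectrum consists of the values at k < n. *)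
Definition dft (L : fieldExtType 'F_2) (s : binseq) (n : nat) (g : L)
    (k : nat) : L :=
  \sum_(t < n) s t *: g ^+ (t * k).

(* Main.v *)
Require Import Defs.
From HB Require Import structures.
From mathcomp Require Import all_boot all_order all_algebra all_field.

Set Implicit Arguments.
Unset Strict Implicit.
Unset Printing Implicit Defensive.

Import GRing.Theory.
Local Open Scope ring_scope.

(** Let [T] be the shift operator and [N] the product of the [n_i], and choose
    [e_i] congruent to [1] modulo [n_i] and to [0] modulo [n_j] for [j != i].
    Then [T^(e_i)] shifts only the factor [a^i] of [s], so [f_i(T^(e_i))] kills
    [s]; the minimal polynomial of [s] hence divides [f_i(X^(e_i))], and
    [g_i := gamma^(e_i)] is a root of [f_i] inside [K].  No common extension of
    the fields [F_i] and [K] is needed.  As [f_i] is irreducible, the polynomial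
    identity [A^i_k = alpha_i^(d_i)] carries over from [alpha_i] to [g_i].
    Finally [gamma] is the product of the [g_i], and the sum defining [S_k],
    taken over [N] terms, factors through the Chinese remainder theorem into the
    product of the values [g_i^(d_i) = g_i^d].  Summing over [N] terms rather
    than over [n] changes nothing: both are odd periods, and odd multiples are
    trivial in characteristic [2]. *)

(** * Chinese remaindering over a list of pairwise coprime moduli *)

Section PairwiseCoprime.
Variables (I : eqType) (n : I -> nat).
Hypothesis n_coprime : forall i j, i != j -> coprime (n i) (n j).

Lemma coprime_prod_notin (i : I) (l : seq I) :
  i \notin l -> coprime (n i) (\prod_(j <- l) n j).
Proof.
elim: l => [|j l IHl]; first by rewrite big_nil coprimen1.
by rewrite inE negb_or big_cons coprimeMr => /andP[/n_coprime-> /IHl].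
Qed.

Lemma eqn_mod_prod (l : seq I) (x y : nat) : uniq l ->
  {in l, forall i, x = y %[mod n i]} -> x = y %[mod \prod_(i <- l) n i].
Proof.
elim: l => [|i l IHl] /=; first by rewrite big_nil !modn1.
move=> /andP[iNl l_uniq] xy; rewrite big_cons; apply/eqP.
rewrite chinese_remainder ?coprime_prod_notin // xy ?mem_head // eqxx /=.
by apply/eqP/IHl => // j jl; apply: xy; rewrite inE jl orbT.
Qed.

Lemma crt_idempotent (l : seq I) (i : I) : uniq l ->
  exists e : nat, e = 1 %[mod n i] /\
    {in l, forall j, j != i -> e = 0 %[mod n j]}.
Proof.
(* Merging all the other moduli into [M] leaves a Chinese remainder problem with two coprime
   moduli. *)
move=> l_uniq; set M := (\prod_(j <- rem i l) n j)%N.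
have coM : coprime (n i) M by rewrite coprime_prod_notin ?mem_rem_uniq ?inE ?eqxx.
exists (chinese (n i) M 1 0); split=> [|j jl ji]; first exact: chinese_modl.
have dvdM : (n j %| M)%N.
  by rewrite /M (big_rem j) ?dvdn_mulr //= mem_rem_uniq // inE ji.
by rewrite -(modn_dvdm _ dvdM) (chinese_modr coM) modn_dvdm.
Qed.

End PairwiseCoprime.

(** * Sums over periods *)

Lemma sum_mul_coprime (R : comNzRingType) (m n : nat) (u v : nat -> R) :
    (0 < m)%N -> (0 < n)%N -> coprime m n ->
    (forall t, u (t %% m)%N = u t) -> (forall t, v (t %% n)%N = v t) ->
  \sum_(t < m * n) u t * v t = (\sum_(t < m) u t) * (\sum_(t < n) v t).
Proof.
move=> m_gt0 n_gt0 co_mn um vn.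
rewrite big_distrlr /= pair_bigA /=.
(* Pairs of residues index the double sum; [h] is injective by the Chinese remainder theorem, hence
   bijective by cardinality. *)
pose h (t : 'I_(m * n)) :=
  (Ordinal (ltn_pmod t m_gt0), Ordinal (ltn_pmod t n_gt0)).
have h_inj : injective h.
  move=> x y [xym xyn]; apply: val_inj => /=.
  have /eqP : x = y %[mod m * n].
    by apply/eqP; rewrite chinese_remainder // xym xyn !eqxx.
  by rewrite !modn_small // => /eqP.
have h_bij : bijective h.
  by apply: inj_card_bij => //; rewrite card_prod !card_ord.
rewrite (reindex h) /=; last exact: onW_bij.
by apply: eq_bigr => t _; rewrite um vn.
Qed.

Lemma sum_prod_coprime (R : comNzRingType) (I : eqType) (n : I -> nat)
    (u : I -> nat -> R) (l : seq I) :
    (forall i j, i != j -> coprime (n i) (n j)) -> (forall i, 0 < n i)%N ->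
    (forall i t, u i (t %% n i)%N = u i t) -> uniq l ->
  \sum_(t < \prod_(i <- l) n i) \prod_(i <- l) u i t
    = \prod_(i <- l) \sum_(t < n i) u i t.
Proof.
move=> n_co n_gt0 un; elim: l => [|i l IHl] /=.
  by rewrite !big_nil big_ord1 big_nil.
move=> /andP[iNl l_uniq]; rewrite [RHS]big_cons -IHl //.
rewrite -(@sum_mul_coprime _ _ _ (u i) (fun t => \prod_(j <- l) u j t)) //.
- by rewrite big_cons; apply: eq_bigr => t _; rewrite big_cons.
- by rewrite prodn_gt0.
- exact: coprime_prod_notin.
move=> t; apply: eq_big_seq => j jl.
by rewrite -un modn_dvdm ?un // (big_rem j) //= dvdn_mulr.
Qed.

Lemma sum_periodic (V : nmodType) (u : nat -> V) (m n : nat) :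
    (forall t, u (t + n)%N = u t) ->
  \sum_(t < m * n) u t = (\sum_(t < n) u t) *+ m.
Proof.
move=> un; elim: m => [|m IHm]; first by rewrite big_ord0.
rewrite mulSn big_split_ord /= mulrS -IHm; congr (_ + _).
by apply: eq_bigr => t _; rewrite addnC un.
Qed.

Lemma mulrn_odd_F2 (V : lmodType 'F_2) (x : V) (m : nat) : odd m -> x *+ m = x.
Proof.
move=> m_odd; rewrite -scaler_nat -Fp_nat_mod // modn2 m_odd scale1r //.
Qed.

(** The sum over [m * n] terms is [n] copies of the first sum and [m] copies of the second, and both
    multiplicities are odd. *)
Lemma sum_odd_periods (V : lmodType 'F_2) (u : nat -> V) (m n : nat) :
    odd m -> odd n ->
    (forall t, u (t + m)%N = u t) -> (forall t, u (t + n)%N = u t) ->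
  \sum_(t < m) u t = \sum_(t < n) u t.
Proof.
move=> m_odd n_odd um un.
rewrite -(mulrn_odd_F2 (\sum_(t < m) _) n_odd) -sum_periodic //.
by rewrite mulnC sum_periodic // mulrn_odd_F2.
Qed.

(** * Polynomials in the shift operator *)

(* [shift_act s t p] is the term of index [t] of the sequence [p(T) s], where
   [T] is the shift operator. *)
Definition shift_act (s : binseq) (t : nat) (p : {poly 'F_2}) : 'F_2 :=
  \sum_(j < size p) p`_j * s (t + j)%N.

(** A bound common to several polynomials allows comparing their actions term by term. *)
Lemma shift_act_wide (s : binseq) (t b : nat) (p : {poly 'F_2}) :
  (size p <= b)%N -> shift_act s t p = \sum_(j < b) p`_j * s (t + j)%N.
Proof.
move=> pb; rewrite /shift_act.
rewrite (big_ord_widen b (fun j => p`_j * s (t + j)%N) pb) big_mkcond /=.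
by apply: eq_bigr => j _; case: ltnP => // pj; rewrite nth_default ?mul0r.
Qed.

Fact shift_act_is_linear (s : binseq) (t : nat) :
  linear (shift_act s t : {poly 'F_2} -> ('F_2)^o).
Proof.
move=> c p q; pose b := maxn (size p) (size q).
have cpq_b : (size (c *: p + q)%R <= b)%N.
  rewrite (leq_trans (size_polyD _ _)) // geq_max leq_maxr andbT.
  exact: leq_trans (size_scale_leq _ _) (leq_maxl _ _).
rewrite !(@shift_act_wide _ _ b) ?leq_maxl ?leq_maxr //.
rewrite scaler_sumr -big_split /=; apply: eq_bigr => j _.
by rewrite coefD coefZ mulrDl -mulrA.
Qed.

HB.instance Definition _ (s : binseq) (t : nat) :=
  GRing.isLinear.Build 'F_2 {poly 'F_2} ('F_2)^o *:%R (shift_act s t)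
    (shift_act_is_linear s t).

Lemma shift_actXn (s : binseq) (t k : nat) : shift_act s t 'X^k = s (t + k)%N.
Proof.
rewrite /shift_act size_polyXn big_ord_recr /= coefXn eqxx mul1r big1 ?add0r //.
by move=> j _; rewrite coefXn ltn_eqF ?mul0r.
Qed.

Lemma shift_act_mulX (s : binseq) (t : nat) (p : {poly 'F_2}) :
  shift_act s t (p * 'X) = shift_act s t.+1 p.
Proof.
rewrite (@shift_act_wide _ _ (size p).+1); last first.
  by rewrite (leq_trans (size_polyMleq _ _)) // size_polyX addn2.
rewrite big_ord_recl coefMX mul0r add0r; apply: eq_bigr => j _.
by rewrite coefMX /= addnS addSn.
Qed.

Definition annihilates (p : {poly 'F_2}) (s : binseq) : Prop :=
  forall t, shift_act s t p = 0.

(** A factor ['X] only advances the starting index, and annihilation is required at every index. *)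
Lemma annihilates_mull (q p : {poly 'F_2}) (s : binseq) :
  annihilates p s -> annihilates (q * p) s.
Proof.
move=> ps; elim/poly_ind: q => [|q c IHq] t; first by rewrite mul0r linear0.
rewrite mulrDl linearD mul_polyC linearZ /= ps scaler0 addr0 mulrAC.
by rewrite shift_act_mulX IHq.
Qed.

Lemma annihilatesB (p q : {poly 'F_2}) (s : binseq) :
  annihilates p s -> annihilates q s -> annihilates (p - q) s.
Proof. by move=> ps qs t; rewrite linearB /= ps qs subr0. Qed.

(** In characteristic 2 the leading term changes sides without a sign. *)
Lemma monic_recurrenceP (f : {poly 'F_2}) (s : binseq) :
  f \is monic -> satisfies_recurrence f s <-> annihilates f s.
Proof.
move=> f_monic.
have act_f t : shift_act s t f =
    \sum_(j < (size f).-1) f`_j * s (t + j)%N + s (t + (size f).-1)%N.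
  rewrite (@shift_act_wide _ _ (size f).-1.+1) ?leqSpred // big_ord_recr /=.
  by rewrite -lead_coefE (monicP f_monic) mul1r.
by split=> fs t; [rewrite act_f -fs|move: (fs t); rewrite act_f => /eqP;
  rewrite addr_eq0 => /eqP->]; rewrite ?oppr_pchar2 ?addrr_pchar2 // pchar_Fp.
Qed.

(** The remainder of [g] by [f] annihilates [s]; if nonzero, it would become, once made monic, a
    recurrence shorter than [f]. *)
Lemma minimal_poly_dvd (s : binseq) (f g : {poly 'F_2}) :
  is_minimal_poly s f -> annihilates g s -> f %| g.
Proof.
move=> [f_monic /(monic_recurrenceP _ f_monic) fs f_min] gs.
rewrite /dvdp; apply/negPn/negP => r_neq0; set r := g %% f in r_neq0.
have rs : annihilates r s.
  have -> : r = g - (g %/ f) * f by rewrite {1}(divp_eq g f) addrC addKr.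
  exact/annihilatesB/annihilates_mull.
pose c := (lead_coef r)^-1.
have c_neq0 : c != 0 by rewrite invr_eq0 lead_coef_eq0.
have cr_monic : c *: r \is monic.
  by rewrite monicE lead_coefZ mulVf // lead_coef_eq0.
have crs : satisfies_recurrence (c *: r) s.
  by apply/(monic_recurrenceP _ cr_monic) => t; rewrite linearZ /= rs scaler0.
by have := f_min _ cr_monic crs; rewrite size_scale // leqNgt ltn_modp monic_neq0.
Qed.

Lemma annihilates_Xn_sub1 (s : binseq) (n : nat) :
  annihilates ('X^n - 1) s <-> forall t, s (t + n)%N = s t.
Proof.
have act t : shift_act s t ('X^n - 1) = s (t + n)%N - s t.
  by rewrite linearB /= shift_actXn -(expr0 'X) shift_actXn addn0.
split=> sn t; first by apply/eqP; rewrite -subr_eq0 -act sn.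
by rewrite act sn subrr.
Qed.

Lemma periodic_modn (T : Type) (u : nat -> T) (n : nat) :
  (forall t, u (t + n)%N = u t) -> forall t, u (t %% n)%N = u t.
Proof.
move=> un t; rewrite {2}(divn_eq t n) addnC.
by elim: (t %/ n)%N => [|q IHq]; rewrite ?addn0 // mulSn addnCA addnC un.
Qed.

Lemma irreducible_root_dvd (F : fieldType) (L : fieldExtType F)
    (f g : {poly F}) (x : L) :
    irreducible_poly f -> root (map_poly (in_alg L) f) x ->
  root (map_poly (in_alg L) g) x -> f %| g.
Proof.
move=> f_irr fx gx; apply/negPn/negP => fNg.
(* Coprimality survives the extension of scalars and excludes a common root. *)
have co_fg : coprimep (map_poly (in_alg L) f) (map_poly (in_alg L) g).
  by rewrite coprimep_map irreducible_poly_coprime.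
by move/negP: (coprimep_root co_fg fx); apply.
Qed.

Lemma map_root_dvdp (F : fieldType) (L : fieldExtType F) (f g : {poly F})
    (x : L) :
  f %| g -> root (map_poly (in_alg L) f) x -> root (map_poly (in_alg L) g) x.
Proof. by rewrite -(dvdp_map (in_alg L)) => /root_dvdp; apply. Qed.

Lemma root_Xn_sub1 (F : fieldType) (L : fieldExtType F) (n : nat) (x : L) :
  root (map_poly (in_alg L) ('X^n - 1)) x = (x ^+ n == 1).
Proof.
by rewrite rmorphB rmorph1 /= map_polyXn rootE !hornerE subr_eq0.
Qed.

Lemma minimal_poly_root_period (s : binseq) (f : {poly 'F_2})
    (L : fieldExtType 'F_2) (x : L) (n : nat) :
    is_minimal_poly s f -> root (map_poly (in_alg L) f) x ->
  (forall t, s (t + n)%N = s t) -> x ^+ n = 1.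
Proof.
move=> f_min fx sn; apply/eqP; rewrite -root_Xn_sub1.
apply: map_root_dvdp fx; apply: (minimal_poly_dvd f_min).
exact/annihilates_Xn_sub1.
Qed.

Lemma dft_periodic (L : fieldExtType 'F_2) (s : binseq) (n k : nat) (x : L) :
    (forall t, s (t + n)%N = s t) -> x ^+ n = 1 ->
  forall t, s (t + n)%N *: x ^+ ((t + n) * k) = s t *: x ^+ (t * k).
Proof.
by move=> sn xn t; rewrite sn mulnDl exprD [x ^+ (n * k)]exprM xn expr1n mulr1.
Qed.

(** The equation at [x] says that [x] is a root of a polynomial over GF(2). The irreducible [f] then
    divides it, so every root of [f], in any extension, satisfies the same equation. *)
Lemma dft_conjugate (L M : fieldExtType 'F_2) (f : {poly 'F_2}) (s : binseq)
    (x : L) (y : M) (n k d : nat) :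
    irreducible_poly f -> root (map_poly (in_alg L) f) x ->
    root (map_poly (in_alg M) f) y ->
  dft s n x k = x ^+ d -> dft s n y k = y ^+ d.
Proof.
move=> f_irr fx fy dft_x.
pose g : {poly 'F_2} := \sum_(t < n) s t *: 'X^(t * k) - 'X^d.
have gE (E : fieldExtType 'F_2) (z : E) :
    root (map_poly (in_alg E) g) z = (dft s n z k == z ^+ d).
  rewrite rootE rmorphB /= map_polyXn hornerD hornerN hornerXn subr_eq0.
  rewrite rmorph_sum /= horner_sum; congr (_ == _); apply: eq_bigr => t _.
  by rewrite linearZ /= map_polyXn hornerZ hornerXn mulr_algl.
apply/eqP; rewrite -gE; apply: map_root_dvdp fy.
by apply: irreducible_root_dvd f_irr fx _; rewrite gE; apply/eqP.
Qed.

(** * Substituting a power of the indeterminate *)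

Lemma root_comp_Xn (F : fieldType) (L : fieldExtType F) (f : {poly F}) (e : nat)
    (x : L) :
  root (map_poly (in_alg L) (f \Po 'X^e)) x =
    root (map_poly (in_alg L) f) (x ^+ e).
Proof. by rewrite map_comp_poly map_polyXn !rootE horner_comp hornerXn. Qed.

Lemma shift_act_comp_Xn (s : binseq) (t e : nat) (f : {poly 'F_2}) :
  shift_act s t (f \Po 'X^e) = \sum_(j < size f) f`_j * s (t + e * j)%N.
Proof.
rewrite comp_polyE linear_sum /=; apply: eq_bigr => j _.
by rewrite linearZ /= -exprM shift_actXn.
Qed.

(** A shift of [s] by [e * q] moves [a i] by [q] and fixes the other factors, which therefore come
    out of the sum as a constant. *)
Lemma annihilates_product (r : nat) (n : 'I_r -> nat) (a : 'I_r -> binseq)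
    (s : binseq) (f : {poly 'F_2}) (i : 'I_r) (e : nat) :
    (forall t, s t = \prod_(j < r) a j t) ->
    (forall j t, a j (t + n j)%N = a j t) ->
    annihilates f (a i) -> e = 1 %[mod n i] ->
    (forall j, j != i -> e = 0 %[mod n j]) ->
  annihilates (f \Po 'X^e) s.
Proof.
move=> sE an fa ei ej t.
have am j x y : x = y %[mod n j] -> a j x = a j y.
  by move=> xy; rewrite -(periodic_modn (an j) x) xy periodic_modn.
have sT q : s (t + e * q)%N = a i (t + q)%N * \prod_(j < r | j != i) a j t.
  rewrite sE (bigD1 i) //=; congr (_ * _).
    by apply: am; rewrite -modnDmr -modnMml ei modnMml mul1n modnDmr.
  apply: eq_bigr => j ji; apply: am.
  by rewrite -modnDmr -modnMml (ej j ji) mod0n mul0n mod0n addn0.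
rewrite shift_act_comp_Xn.
under eq_bigr => j _ do rewrite sT mulrA.
by rewrite -mulr_suml [X in X * _](fa t) mul0r.
Qed.

Lemma primitive_poly_dvd (f : {poly 'F_2}) :
  primitive_poly f ->
  irreducible_poly f /\ f %| 'X^(2 ^ (size f).-1 - 1) - 1.
Proof.
move=> f_prim; case/and4P: (f_prim) => _ /irreducibleP f_irr.
by rewrite (card_primitive_qpoly f_prim) card_Fp // subn1.
Qed.

Theorem theorem2 (r : nat) (hr : (1 <= r)%N)
  (p nn : 'I_r -> nat) (f : 'I_r -> {poly 'F_2}) (a : 'I_r -> binseq)
  (hp : forall i, size (f i) = (p i).+1)
  (hf : forall i, primitive_poly (f i))
  (ha : forall i, lfsr_output (f i) (a i))
  (ha0 : forall i, nonzero_initial_state (f i) (a i))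
  (hnn : forall i, nn i = (2 ^ p i - 1)%N)
  (hcop : forall i j, i != j -> coprime (nn i) (nn j))
  (s : binseq) (hs : forall t, s t = \prod_(i < r) a i t)
  (n : nat) (hn : has_period s n)
  (m : nat) (hm : (0 < m)%N) (hnm : (n %| 2 ^ m - 1)%N)
  (F : 'I_r -> fieldExtType 'F_2) (hF : forall i, \dim {:F i} = p i)
  (alpha : forall i, F i) (mu : 'I_r -> {poly 'F_2})
  (hmu : forall i, is_minimal_poly (a i) (mu i))
  (halpha : forall i, root (map_poly (in_alg (F i)) (mu i)) (alpha i))
  (K : fieldExtType 'F_2) (hK : \dim {:K} = m)
  (gamma : K) (mus : {poly 'F_2}) (hmus : is_minimal_poly s mus)
  (hgamma : root (map_poly (in_alg K) mus) gamma)
  (k : nat) (hk : (k < n)%N)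
  (hA : forall i, dft (a i) (nn i) (alpha i) (k %% nn i)%N != 0)
  (d_ : 'I_r -> nat)
  (hd_ : forall i, dft (a i) (nn i) (alpha i) (k %% nn i)%N = alpha i ^+ d_ i)
  (d : nat) (hd : forall i, d = d_ i %[mod nn i]) :
  dft s n gamma k = gamma ^+ d.
Proof.
have f_irr i : irreducible_poly (f i) by have [] := primitive_poly_dvd (hf i).
have p_gt0 i : (0 < p i)%N by case: (f_irr i) => + _; rewrite hp.
have nn_gt0 i : (0 < nn i)%N by rewrite hnn subn_gt0 -{1}(expn0 2) ltn_exp2l.
have nn_odd i : odd (nn i).
  by rewrite hnn oddB ?expn_gt0 // oddX (gtn_eqF (p_gt0 i)).
have fa i : annihilates (f i) (a i).
  by have [f_monic] := ha i; move/(monic_recurrenceP _ f_monic).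
have a_per i : forall t, a i (t + nn i)%N = a i t.
  apply/annihilates_Xn_sub1; have [_] := primitive_poly_dvd (hf i).
  by rewrite hp -hnn => /dvdpP[q ->]; apply: annihilates_mull.
have a_mod i t t' : t = t' %[mod nn i] -> a i t = a i t'.
  by move=> tt'; rewrite -(periodic_modn (a_per i)) tt' periodic_modn.
(* [alpha i] is given as a root of [mu i], which divides [f i] because [f i] annihilates [a i]. *)
have f_alpha i : root (map_poly (in_alg (F i)) (f i)) (alpha i).
  by apply: map_root_dvdp (halpha i); apply: minimal_poly_dvd (hmu i) (fa i).
have alpha_nn i : alpha i ^+ nn i = 1.
  exact: minimal_poly_root_period (hmu i) (halpha i) (a_per i).
pose N := (\prod_(i <- enum 'I_r) nn i)%N.
have dvdN i : (nn i %| N)%N by rewrite /N (big_rem i) ?mem_enum ?dvdn_mulr.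
have N_odd : odd N.
  by apply: (big_ind odd) => // x y x_odd y_odd; rewrite oddM x_odd.
have s_N t : s (t + N)%N = s t.
  rewrite !hs; apply: eq_bigr => i _; apply: a_mod.
  by rewrite -modnDmr (eqP (dvdN i)) addn0.
have [_ s_n _] := hn.
have n_odd : odd n.
  apply: dvdn_odd hnm _.
  by rewrite oddB ?expn_gt0 // oddX (gtn_eqF hm).
have gamma_n := minimal_poly_root_period hmus hgamma s_n.
have gamma_N := minimal_poly_root_period hmus hgamma s_N.
have /fin_all_exists [e eP] := fun i => crt_idempotent hcop i (enum_uniq 'I_r).
have e1 i : e i = 1 %[mod nn i] by case: (eP i).
have e0 i j : j != i -> e i = 0 %[mod nn j].
  by case: (eP i) => _; apply; rewrite mem_enum.
pose g i := gamma ^+ e i.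
have f_g i : root (map_poly (in_alg K) (f i)) (g i).
  rewrite -root_comp_Xn; apply: map_root_dvdp hgamma.
  apply: minimal_poly_dvd hmus _.
  exact: annihilates_product hs a_per (fa i) (e1 i) (e0 i).
(* The sum of the [e i] is 1 modulo each [nn i], hence modulo [N], and [gamma ^+ N = 1]. *)
have gE : gamma = \prod_(i <- enum 'I_r) g i.
  rewrite -expr_sum -(expr_mod _ gamma_N) -[LHS]expr1 -(expr_mod 1 gamma_N).
  congr (_ ^+ _); apply: eqn_mod_prod hcop _ _ _ (enum_uniq _) _ => i _.
  rewrite (bigD1_seq i) ?mem_enum ?enum_uniq //=.
  have /eqP sum_e : (nn i %| \sum_(j <- enum 'I_r | j != i) e j)%N.
    by apply: dvdn_sum => j ji; rewrite /dvdn e0 ?mod0n // eq_sym.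
  by rewrite -modnDmr sum_e addn0 e1.
have g_nn i : g i ^+ nn i = 1.
  by apply/eqP; rewrite -root_Xn_sub1; apply: map_root_dvdp (f_g i);
    have [_] := primitive_poly_dvd (hf i); rewrite hp -hnn.
have dft_g i : dft (a i) (nn i) (g i) k = g i ^+ d.
  (* The index [k] may replace its residue modulo [nn i], since [alpha i ^+ nn i = 1]. *)
  have dft_alpha : dft (a i) (nn i) (alpha i) k = alpha i ^+ d_ i.
    rewrite -hd_; apply: eq_bigr => t _; congr (_ *: _).
    by rewrite -(expr_mod _ (alpha_nn i)) -modnMmr expr_mod.
  rewrite (dft_conjugate (f_irr i) (f_alpha i) (f_g i) dft_alpha).
  by rewrite -(expr_mod _ (g_nn i)) -hd expr_mod.
rewrite /dft (sum_odd_periods n_odd N_odd (dft_periodic k s_n gamma_n)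
  (dft_periodic k s_N gamma_N)).
pose u i t := a i t *: g i ^+ (t * k) : K.
transitivity (\sum_(t < N) \prod_(i <- enum 'I_r) u i t).
  (* The scalars multiply to [s t], and the powers of the [g i] to the power of [gamma]. *)
  apply: eq_bigr => t _; rewrite scaler_prod big_enum -hs {1}gE.
  by rewrite -prodrXl.
rewrite sum_prod_coprime ?enum_uniq //; last first.
  by move=> i; apply: periodic_modn; apply: dft_periodic.
by rewrite {1}gE -prodrXl; apply: eq_bigr => i _; rewrite -dft_g.
Qed.
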